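(* There exist two proper translation-invariant distances $d_1$, $d_2$ on $\mathbb{R}$, each inducing the standard topology of $\mathbb{R}$, such that the Hausdorff dimension of $(\mathbb{R},d_1)$ is infinite and $$\dim_{top}(\mathbb{R},d_2)\neq\dim_H(\mathbb{R},d_2)\neq \dim_{Ass}(\mathbb{R},d_2).$$
   Context: A distance $d$ on $\mathbb{R}$ is translation-invariant if $d(x,y)=d(x+v,y+v)$ for all $x,y,v\in\mathbb{R}$. A distance is proper if all its closed balls are compact. Here $\dim_{top}$ denotes topological dimension and $\dim_H$ Hausdorff dimension. The Assouad dimension $\dim_{Ass}(X)$ of a metric space $X$ is the infimum (possibly $+\infty$) of all numbers $\beta>0$ for which there is some $C>1$ such that, for all $D>0$ and all $\epsilon\in(0,1)$, every set of diameter $D$ can be covered by at most $C\epsilon^{-\beta}$ sets of diameter at most $\epsilon D$. *)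

(* Defs.v *)
From HB Require Import structures.
From mathcomp Require Import all_boot all_order all_algebra.
From mathcomp Require Import all_classical all_reals all_analysis.

Set Implicit Arguments.
Unset Strict Implicit.
Unset Printing Implicit Defensive.

Import Order.TTheory GRing.Theory Num.Theory.
Import numFieldNormedType.Exports.

Local Open Scope classical_set_scope.
Local Open Scope ring_scope.

Record distance (R : realType) := Distance {
  dist_fun :> R -> R -> R;
  dist_xx : forall x, dist_fun x x = 0;
  dist_positivity : forall x y, dist_fun x y = 0 -> x = y;
  dist_sym : forall x y, dist_fun x y = dist_fun y x;
  dist_triangle : forall y x z, dist_fun x z <= dist_fun x y + dist_fun y z
}.

(* An alias of the carrier of R.  Only the choice structure is copied from R:
   the topology of [metric_space d] is the one induced by d. *)
Definition metric_space (R : realType) (d : distance R) : Type := R.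

HB.instance Definition _ (R : realType) (d : distance R) :=
  Choice.copy (metric_space d) R.

HB.instance Definition _ (R : realType) (d : distance R) :=
  isMetric.Build R (metric_space d)
    (dist_xx d) (@dist_positivity R d) (dist_sym d) (dist_triangle d).

Definition translation_invariant (R : realType) (d : distance R) :=
  forall x y v : R, d x y = d (x + v) (y + v).

(* The library's [closed_ball] is the closure of the open ball, which may be
   smaller than the closed ball of the metric. *)
Definition proper_space (R : realType) (T : metricType R) :=
  forall (x : T) (r : R), compact [set y : T | mdist x y <= r].

Definition induces_standard_topology (R : realType) (d : distance R) :=
  forall A : set R, @open (metric_space d) A <-> @open R A.

Definition open_cover (T : topologicalType) (F : set (set T)) :=
  (forall A, F A -> open A) /\ \bigcup_(A in F) A = setT.

Definition refines (T : Type) (G F : set (set T)) :=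
  forall B, G B -> exists2 A, F A & B `<=` A.

Definition order_at_most (T : Type) (k : nat) (G : set (set T)) :=
  forall x : T, ([set B | G B /\ B x] #<= `I_k)%card.

(* Lebesgue covering dimension: it is at most n iff every open cover has an
   open refinement in which each point lies in at most k = n + 1 members; the
   value is -1 on the empty space. *)
Definition topological_dim (R : realType) (T : topologicalType) : \bar R :=
  ereal_inf [set (k%:R - 1)%:E | k in [set k : nat |
    forall F : set (set T), open_cover F ->
      exists G, [/\ open_cover G, refines G F & order_at_most k G]]].

Section MetricDimensions.
Local Open Scope ereal_scope.

(* The element 0 only matters for the empty set, whose diameter is thus 0. *)
Definition diam (R : realType) (T : metricType R) (A : set T) : \bar R :=
  ereal_sup (0 |` [set (mdist x y)%:E | x in A & y in A]).

Definition hausdorff_content (R : realType) (T : metricType R)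
    (s delta : R) (A : set T) : \bar R :=
  ereal_inf [set \sum_(0 <= i <oo) (diam (U i) `^ s) |
    U in [set U : nat -> set T |
      A `<=` \bigcup_i U i /\ forall i, diam (U i) <= delta%:E]].

Definition hausdorff_measure (R : realType) (T : metricType R)
    (s : R) (A : set T) : \bar R :=
  ereal_sup [set hausdorff_content s delta A |
    delta in [set delta : R | (0 < delta)%R]].

(* Restricting to s > 0 avoids the convention on 0 ^ 0 and does not change
   the infimum on a nonempty space. *)
Definition hausdorff_dim (R : realType) (T : metricType R) : \bar R :=
  ereal_inf [set s%:E | s in [set s : R |
    (0 < s)%R /\ hausdorff_measure s [set: T] = 0]].

Definition assouad_dim (R : realType) (T : metricType R) : \bar R :=
  ereal_inf [set beta%:E | beta in [set beta : R | (0 < beta)%R /\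
    exists2 C : R, (1 < C)%R &
      forall D eps : R, (0 < D)%R -> (0 < eps < 1)%R ->
      forall A : set T, diam A = D%:E ->
      exists (n : nat) (U : nat -> set T),
        [/\ (n%:R <= C * eps `^ (- beta))%R,
            A `<=` \bigcup_(i < n) U i &
            forall i, (i < n)%N -> diam (U i) <= (eps * D)%:E]]].

End MetricDimensions.

(* Main.v *)
Require Import Defs.
From mathcomp Require Import all_boot all_order all_algebra.
From mathcomp Require Import all_classical all_reals all_analysis.
From mathcomp Require Import ring lra.

Set Implicit Arguments.
Unset Strict Implicit.
Unset Printing Implicit Defensive.

Import Order.TTheory GRing.Theory Num.Theory.
Import numFieldNormedType.Exports.

Local Open Scope classical_set_scope.
Local Open Scope ring_scope.

(** Both distances have the form f |x - y| for a suitable profile f, so they are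
    translation-invariant by construction.  For such a distance to be a proper
    metric inducing the usual topology it suffices that f vanishes exactly at 0,
    is small near 0, tends to infinity, is nondecreasing and has f t / t
    nonincreasing; the last two conditions give subadditivity
    ([gauge_subadditive]).  The dimensions are then read off from f.

    Lower bounds come from one counting principle ([itv_cover_le_sum]): sets
    covering an interval have total Euclidean width at least half its length.
    If t <= c (f t)^p for all t with f t <= 1, then the p-th powers of the
    f-diameters of a cover dominate Euclidean widths, so the Hausdorff dimension
    is at least p ([hausdorff_dim_ge]).

    For the first distance, f is the supremum over n of t^(1/n) / n.  It lies
    above every t^(1/n) / n, so the Hausdorff dimension is at least n for every n.

    For the second one, f t = min (t^(4/5), t^(1/4)), which is t^(4/5) below 1 and
    t^(1/4) above 1.  The Hausdorff dimension sees only small scales.  It is at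
    least 5/4 by the principle above, and at most 15/8: the line is covered by
    Euclidean intervals of lengths t/1, t/2, t/3, ..., whose lengths have infinite
    sum while the 15/8-th powers of their f-diameters sum to at most
    t^(3/2) (1 + 2^(-3/2) + 3^(-3/2) + ...), which vanishes with t
    ([hausdorff_dim_le]).  Hence the Hausdorff dimension lies strictly between 1
    and 2, whereas the topological dimension, an infimum of integers, cannot
    ([topological_dim_notin_itv12]).  The Assouad dimension also sees large
    scales, where f behaves like t^(1/4): the segment [0, D^4] has diameter D and
    needs at least D^4 / 2 sets of diameter at most 1, so the dimension is at
    least 4 ([assouad_dim_ge]). *)

(** * Gauges *)

(** The profiles f for which f |x - y| is a distance of the required kind.  The
    field [gauge_slope] says that f t / t is nonincreasing; the product form
    also makes sense at 0.  Unlike concavity, this is preserved by both minima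
    and suprema. *)
Record gauge (R : realType) (f : R -> R) : Prop := Gauge {
  gauge0 : f 0 = 0;
  gauge_gt0 : forall t, 0 < t -> 0 < f t;
  gauge_le : forall s t, 0 <= s -> s <= t -> f s <= f t;
  gauge_slope : forall s t, 0 <= s -> s <= t -> s * f t <= t * f s;
  gauge_small : forall e, 0 < e -> exists2 t, 0 < t & f t < e;
  gauge_unbounded : forall M, exists2 t, 0 <= t & M < f t
}.

Section Gauge.
Context (R : realType).
Implicit Types f g : R -> R.

(** Writing (s + t) f(s + t) = s f(s + t) + t f(s + t), each term on the right
    is bounded by the slope condition. *)
Lemma gauge_subadditive f s t : gauge f -> 0 <= s -> 0 <= t ->
  f (s + t) <= f s + f t.
Proof.
move=> gf s0 t0; have [st0|st0] := eqVneq (s + t) 0.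
  have -> : s = 0 by lra.
  have -> : t = 0 by lra.
  by rewrite addr0 (gauge0 gf) addr0.
have stp : 0 < s + t by rewrite lt_def st0 addr_ge0.
rewrite -(ler_pM2l stp) mulrDl mulrDr.
by apply: lerD; apply: (gauge_slope gf); rewrite // ?lerDl ?lerDr.
Qed.

Lemma gauge_ge0 f t : gauge f -> 0 <= t -> 0 <= f t.
Proof.
move=> gf; rewrite le_eqVlt => /predU1P[<-|/(gauge_gt0 gf)/ltW//].
by rewrite (gauge0 gf).
Qed.

Lemma gauge_lt_inv f s t : gauge f -> 0 <= t -> f s < f t -> s < t.
Proof. by move=> gf t0; apply: contraTT; rewrite -!leNgt; exact: gauge_le. Qed.

Lemma gauge_powR a : 0 < a <= 1 -> gauge (fun t : R => t `^ a).
Proof.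
move=> /andP[a0 a1]; have aN0 : a != 0 by rewrite gt_eqF.
split => [|t|s t s0 st|s t s0 st|e e0|M].
- by rewrite powR0.
- exact: powR_gt0.
- by rewrite ge0_ler_powR ?nnegrE ?(ltW a0)// (le_trans s0).
- have t0 := le_trans s0 st.
  (* both sides contain the factor s^a t^a; what remains is s^(1-a) <= t^(1-a) *)
  have split_pow x : 0 <= x -> x = x `^ (1 - a) * x `^ a.
    by move=> x0; rewrite -powRD subrK ?powRr1 ?oner_eq0.
  rewrite [leLHS](_ : _ = s `^ (1 - a) * (s `^ a * t `^ a)); last first.
    by rewrite {1}(split_pow s)// mulrA.
  rewrite [leRHS](_ : _ = t `^ (1 - a) * (s `^ a * t `^ a)); last first.
    by rewrite {1}(split_pow t)// -mulrA [t `^ a * _]mulrC.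
  rewrite ler_wpM2r ?mulr_ge0 ?powR_ge0// ge0_ler_powR ?nnegrE//.
  by rewrite subr_ge0.
- have h0 : 0 < e / 2 by rewrite divr_gt0.
  exists ((e / 2) `^ a^-1); first exact: powR_gt0.
  by rewrite -powRrM mulVf// powRr1 ?ltW//; lra.
- have m0 : 0 <= `|M| + 1 by rewrite addr_ge0.
  exists ((`|M| + 1) `^ a^-1); first exact: powR_ge0.
  by rewrite -powRrM mulVf// powRr1// (le_lt_trans (ler_norm M))// ltrDl.
Qed.

Lemma gauge_min f g : gauge f -> gauge g -> gauge (fun t => Num.min (f t) (g t)).
Proof.
move=> gf gg; split => [|t t0|s t s0 st|s t s0 st|e e0|M].
- by rewrite (gauge0 gf) (gauge0 gg) minxx.
- by rewrite lt_min (gauge_gt0 gf) ?(gauge_gt0 gg).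
- by rewrite le_min !ge_min (gauge_le gf s0 st) (gauge_le gg s0 st) orbT.
- rewrite !minr_pMr ?(le_trans s0 st)//.
  by rewrite le_min !ge_min (gauge_slope gf s0 st) (gauge_slope gg s0 st) orbT.
- by have [t t0 fte] := gauge_small gf e0; exists t; rewrite // gt_min fte.
- have [s s0 Mfs] := gauge_unbounded gf M.
  have [t t0 Mgt] := gauge_unbounded gg M.
  exists (Num.max s t); first by rewrite le_max s0.
  rewrite lt_min (lt_le_trans Mfs) ?(lt_le_trans Mgt)//.
    by rewrite (gauge_le gg)// le_max lexx orbT.
  by rewrite (gauge_le gf)// le_max lexx.
Qed.

End Gauge.

(** * A gauge above multiples of all roots *)

Section SlowGauge.
Context (R : realType).

Definition root_family (t : R) (n : nat) : R := t `^ n.+1%:R^-1 / n.+1%:R.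

(** Near 0 this decays like the inverse of a logarithm, hence more slowly than
    every positive power of t. *)
Definition slow_gauge (t : R) : R := sup (range (root_family t)).

Lemma inv_succ_itv n : 0 < (n.+1%:R^-1 : R) <= 1.
Proof. by rewrite invr_gt0 ltr0n invf_le1 ?ltr0n//= ler1n. Qed.

(** Bounding by (1 + t)^1 makes the family bounded uniformly in n, so that the
    supremum is a genuine one. *)
Lemma root_family_le t n : 0 <= t -> root_family t n <= 1 + t.
Proof.
move=> t0; have /andP[n0 n1] := inv_succ_itv n.
apply: (@le_trans _ _ (t `^ n.+1%:R^-1)).
  by rewrite ler_piMr ?powR_ge0.
apply: (@le_trans _ _ ((1 + t) `^ n.+1%:R^-1)).
  by rewrite ge0_ler_powR ?nnegrE ?addr_ge0 ?lerDr// ltW.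
by rewrite -[leRHS]powRr1 ?addr_ge0// ler_powR// lerDl.
Qed.

Lemma root_family_ubounded t : 0 <= t -> has_ubound (range (root_family t)).
Proof. by move=> t0; exists (1 + t) => _ [n _ <-]; exact: root_family_le. Qed.

Lemma slow_gauge_ge t n : 0 <= t -> root_family t n <= slow_gauge t.
Proof. by move=> t0; apply: (ub_le_sup (root_family_ubounded t0)); exists n. Qed.

Lemma slow_gauge_le_ub t M : (forall n, root_family t n <= M) -> slow_gauge t <= M.
Proof.
move=> tM; apply: sup_le_ub; first by exists (root_family t 0), 0%N.
by move=> _ [n _ <-].
Qed.

Lemma slow_gauge_gauge : gauge slow_gauge.
Proof.
have gr n := gauge_powR (inv_succ_itv n).
have n0 n : 0 < n.+1%:R^-1 :> R by rewrite invr_gt0.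
split => [|t t0|s t s0 st|s t s0 st|e e0|M].
- apply/eqP; rewrite eq_le; apply/andP; split.
    by apply: slow_gauge_le_ub => n; rewrite /root_family (gauge0 (gr n)) mul0r.
  apply: le_trans (slow_gauge_ge 0 (lexx 0)).
  by rewrite /root_family (gauge0 (gr 0%N)) mul0r.
- apply: lt_le_trans (slow_gauge_ge 0 (ltW t0)).
  by rewrite /root_family divr_gt0 ?powR_gt0.
- apply: slow_gauge_le_ub => n.
  apply: le_trans (slow_gauge_ge n (le_trans s0 st)).
  by rewrite ler_wpM2r// ?(ltW (n0 n))// (gauge_le (gr n)).
- move: s0; rewrite le_eqVlt => /predU1P[s0|s0].
    rewrite -s0 mul0r mulr_ge0 ?(le_trans _ st) -?s0//.
    apply: le_trans (slow_gauge_ge 0 (lexx 0)).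
    by rewrite /root_family divr_ge0 ?powR_ge0.
  rewrite mulrC -ler_pdivlMr//; apply: slow_gauge_le_ub => n.
  rewrite ler_pdivlMr// mulrC.
  apply: (@le_trans _ _ (t * root_family s n)); last first.
    by rewrite ler_wpM2l ?slow_gauge_ge ?(le_trans _ st)// ltW.
  by rewrite /root_family !mulrA ler_wpM2r ?(ltW (n0 n))// (gauge_slope (gr n))// ltW.
(* On [0, 1], the terms of index above N are at most 1 / (N + 1), and the others
   are at most t^(1 / (N + 1)): both are below e / 2 for this choice of N and t. *)
- have [N Ne] : exists N : nat, N.+1%:R^-1 < e / 2.
    exists (Num.truncn (e / 2)^-1).
    by rewrite invf_plt ?posrE ?divr_gt0// truncnS_gt.
  pose t := Num.min 1 ((e / 2) `^ N.+1%:R).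
  have t0 : 0 < t by rewrite lt_min ltr01 powR_gt0// divr_gt0.
  exists t => //; apply: (@le_lt_trans _ _ (e / 2)); last by lra.
  apply: slow_gauge_le_ub => n; rewrite /root_family.
  have [nN|Nn] := leqP n N.
    apply: (@le_trans _ _ (t `^ n.+1%:R^-1)).
      by rewrite ler_piMr ?powR_ge0//; have /andP[] := inv_succ_itv n.
    apply: (@le_trans _ _ (t `^ N.+1%:R^-1)).
      apply: ger_powR; last by rewrite lef_pV2 ?posrE// ler_nat.
      by rewrite t0 ge_min lexx.
    apply: (@le_trans _ _ (((e / 2) `^ N.+1%:R) `^ N.+1%:R^-1)).
      by rewrite (gauge_le (gr N)) ?(ltW t0)// /t ge_min lexx orbT.
    by rewrite -powRrM mulfV// powRr1// ltW// divr_gt0.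
  apply: le_trans (ltW Ne); apply: (@le_trans _ _ n.+1%:R^-1).
    rewrite ler_piMl ?(ltW (n0 n))//.
    apply: (@le_trans _ _ (1 `^ n.+1%:R^-1)); last by rewrite powR1.
    by rewrite (gauge_le (gr n)) ?(ltW t0)// /t ge_min lexx.
  by rewrite lef_pV2 ?posrE// ler_nat ltnW.
- exists (`|M| + 1); first by rewrite addr_ge0.
  have m0 : 0 <= `|M| + 1 by rewrite addr_ge0.
  apply: lt_le_trans (slow_gauge_ge 0 m0).
  rewrite /root_family invr1 mulr1 powRr1//.
  by rewrite (le_lt_trans (ler_norm M))// ltrDl.
Qed.

End SlowGauge.

(** * The distance of a gauge *)

Section GaugeDistance.
Context (R : realType) (f : R -> R) (gf : gauge f).

Lemma gauge_dist_xx (x : R) : f `|x - x| = 0.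
Proof. by rewrite subrr normr0 (gauge0 gf). Qed.

Lemma gauge_dist_positivity (x y : R) : f `|x - y| = 0 -> x = y.
Proof.
move=> fxy; apply/eqP; apply: contra_eqT fxy => xy.
by rewrite gt_eqF// (gauge_gt0 gf)// normr_gt0 subr_eq0.
Qed.

Lemma gauge_dist_sym (x y : R) : f `|x - y| = f `|y - x|.
Proof. by rewrite distrC. Qed.

Lemma gauge_dist_triangle (y x z : R) : f `|x - z| <= f `|x - y| + f `|y - z|.
Proof.
by apply: le_trans (gauge_subadditive gf _ _); rewrite ?(gauge_le gf)// ler_distD.
Qed.

Definition gauge_distance : distance R :=
  Distance gauge_dist_xx gauge_dist_positivity gauge_dist_sym gauge_dist_triangle.

Local Notation d := gauge_distance.
Local Notation M := (metric_space gauge_distance).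

Lemma gauge_mdistE (x y : M) : mdist x y = f `|(x : R) - y|.
Proof. by []. Qed.

Lemma gauge_distance_translation_invariant : translation_invariant d.
Proof. by move=> x y v; rewrite /= opprD addrACA subrr addr0. Qed.

(** Since f is monotone, a Euclidean ball of radius t contains the f-ball of
    radius f t, and smallness of f near 0 gives the reverse inclusion. *)
Lemma gauge_nbhsE (x : R) : @nbhs R M x = @nbhs R R x.
Proof.
apply/seteqP; split => A.
- move=> /(@nbhs_ballP R M)[e /= e0 eA].
  have [t t0 fte] := gauge_small gf e0.
  apply/(@nbhs_ballP R R); exists t => //= y xyt; apply: eA.
  rewrite ballEmdist /= gauge_mdistE (le_lt_trans _ fte)// (gauge_le gf)//.
  exact: ltW.
- move=> /(@nbhs_ballP R R)[t /= t0 tA].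
  apply/(@nbhs_ballP R M); exists (f t); first exact: (gauge_gt0 gf).
  move=> y; rewrite ballEmdist /= gauge_mdistE => fxy; apply: tA.
  exact: (gauge_lt_inv gf (ltW t0) fxy).
Qed.

Lemma gauge_distance_standard : induces_standard_topology d.
Proof.
move=> A; rewrite !openE; split=> Ao x /Ao.
  by change (@nbhs R M x A -> @nbhs R R x A); rewrite gauge_nbhsE.
by change (@nbhs R R x A -> @nbhs R M x A); rewrite gauge_nbhsE.
Qed.

(** Closed balls are closed in the metric and, f being unbounded, lie in a
    Euclidean segment; compactness of the segment depends only on the
    neighbourhoods, which are the same for both metrics. *)
Lemma gauge_distance_proper : proper_space M.
Proof.
move=> x r.
have [t t0 rt] := gauge_unbounded gf r.
have clB : closed [set y : M | mdist x y <= r].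
  rewrite -openC openE => y /= /negP; rewrite -ltNge => rxy.
  apply/(@nbhs_ballP R M); exists (mdist x y - r) => /=; first by rewrite subr_gt0.
  move=> z; rewrite ballEmdist /= => yz; apply/negP; rewrite -ltNge.
  have := metric_triangle x z y; rewrite (metric_sym z y); lra.
apply: (@subclosed_compact M _ `[x - t, x + t]) => //; last first.
  move=> y /=; rewrite gauge_mdistE => xyr.
  have := ltW (gauge_lt_inv gf t0 (le_lt_trans xyr rt)).
  by rewrite distrC ler_distl in_itv.
move=> F FF FI; have [y [Iy Fy]] := @segment_compact R (x - t) (x + t) F FF FI.
exists y; split => // A B FA.
change (@nbhs R M y B -> A `&` B !=set0); rewrite gauge_nbhsE.
exact: Fy.
Qed.

Lemma diam_le (A : set M) (e : R) : 0 <= e ->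
  (forall x y : R, A x -> A y -> `|x - y| <= e) -> (diam A <= (f e)%:E)%E.
Proof.
move=> e0 Ae; apply: ge_ereal_sup => _ [->|[x Ax [y Ay <-]]].
  by rewrite lee_fin (gauge_ge0 gf).
by rewrite lee_fin gauge_mdistE (gauge_le gf)// Ae.
Qed.

End GaugeDistance.

Lemma diam_ge (R : realType) (T : metricType R) (A : set T) (x y : T) :
  A x -> A y -> ((mdist x y)%:E <= diam A)%E.
Proof. by move=> Ax Ay; apply: ereal_sup_ubound; right; exists x => //; exists y. Qed.

Lemma diam_ge0 (R : realType) (T : metricType R) (A : set T) : (0 <= diam A)%E.
Proof. by apply: ereal_sup_ubound; left. Qed.

(** * Lower bound for the Hausdorff dimension *)

(** Each U i lies in a segment of length 2 (r i) centred at any of its points, and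
    Lebesgue measure is countably subadditive on these segments.  Passing through
    segments avoids assuming that the U i are measurable. *)
Lemma itv_cover_le_sum (R : realType) (a b : R) (U : nat -> set R) (r : nat -> R) :
  (forall i, 0 <= r i) ->
  (forall i x y, U i x -> U i y -> `|x - y| <= r i) ->
  `[a, b] `<=` \bigcup_i U i ->
  ((b - a)%:E <= \sum_(0 <= i <oo) (2 * r i)%:E)%E.
Proof.
move=> r0 Ur abU.
have [ba|ab] := leP b a.
  apply: (@le_trans _ _ 0%E); first by rewrite lee_fin subr_le0.
  by apply: nneseries_ge0 => i _ _; rewrite lee_fin mulr_ge0.
pose x i := xget (0 : R) (U i).
pose V i : set R := [set` `[x i - r i, x i + r i]].
have UV i : U i `<=` V i.
  move=> y Uy; have Ux : U i (x i) by apply: xgetI Uy.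
  by rewrite /V /= in_itv /= -ler_distl Ur.
have : (lebesgue_measure ([set` `[a, b]] : set R) <=
        \sum_(0 <= i <oo) lebesgue_measure (V i))%E.
  apply: measure_sigma_subadditive => [i||y /abU[i _ Uy]].
  - exact: measurable_itv.
  - exact: measurable_itv.
  - by exists i => //; exact: UV.
rewrite lebesgue_measure_itv /= lte_fin ab -EFinD => /le_trans; apply.
apply: lee_nneseries => [//|i _].
rewrite /V lebesgue_measure_itv /=; case: ifPn => _.
  by rewrite -EFinB lee_fin; lra.
by rewrite lee_fin mulr_ge0.
Qed.

Section HausdorffLowerBound.
Context (R : realType) (f : R -> R) (gf : gauge f).
Local Notation M := (metric_space (gauge_distance gf)).
Local Open Scope ereal_scope.

(** Stated for all exponents s <= p: covers by sets of diameter at most 1 satisfy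
    diam^p <= diam^s, so the estimate for the exponent p bounds the content of
    scale 1 below by 1 / (2 c) for every such s. *)
Lemma hausdorff_measure_gt0 (s p c : R) : (0 < c)%R -> (0 < s)%R -> (s <= p)%R ->
  (forall t, 0 <= t -> f t <= 1 -> t <= c * f t `^ p)%R ->
  0 < hausdorff_measure s [set: M].
Proof.
move=> c0 s0 sp fc.
have c2 : (0 < 2 * c)%R by rewrite mulr_gt0.
apply: (@lt_le_trans _ _ (2 * c)^-1%:E); first by rewrite lte_fin invr_gt0.
apply: (@le_trans _ _ (hausdorff_content s 1%R [set: M])); last first.
  by apply: ereal_sup_ubound; exists 1%R => //=.
apply: le_ereal_inf_tmp => _ [U [TU U1] <-].
pose e i := fine (diam (U i)).
have eE i : diam (U i) = (e i)%:E.
  rewrite /e fineK// fin_numElt (lt_le_trans _ (diam_ge0 (U i)))//=.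
  by rewrite (le_lt_trans (U1 i))// ltry.
have e0 i : (0 <= e i)%R by rewrite -lee_fin -eE diam_ge0.
have e1 i : (e i <= 1)%R by rewrite -lee_fin -eE U1.
have Ue i x y : U i x -> U i y -> (`|x - y| <= c * e i `^ s)%R.
  move=> Ux Uy; have fe : (f `|x - y| <= e i)%R.
    by rewrite -lee_fin -eE; exact: (diam_ge Ux Uy).
  apply: le_trans (fc _ (normr_ge0 _) (le_trans fe (e1 i))) _.
  rewrite ler_pM2l//; apply: (@le_trans _ _ (e i `^ p)%R).
    by rewrite ge0_ler_powR ?nnegrE ?(gauge_ge0 gf) ?normr_ge0// (le_trans (ltW s0)).
  have := e0 i; rewrite le_eqVlt => /predU1P[<-|ei0].
    by rewrite !powR0// gt_eqF// (lt_le_trans s0).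
  by rewrite ger_powR// ei0 e1.
have := @itv_cover_le_sum R 0 1 U (fun i => c * e i `^ s)%R _ Ue.
move=> /(_ (fun i => mulr_ge0 (ltW c0) (powR_ge0 _ _)) (fun x _ => TU x Logic.I)).
under eq_eseriesr do rewrite mulrA EFinM -poweR_EFin -eE.
rewrite nneseriesZl => [|i _]; last exact: poweR_ge0.
rewrite subr0 -lee_pdivrMl// mule1 => /le_trans; apply; exact: lexx.
Qed.

Lemma hausdorff_dim_ge (p c : R) : (0 < c)%R ->
  (forall t, 0 <= t -> f t <= 1 -> t <= c * f t `^ p)%R ->
  p%:E <= hausdorff_dim M.
Proof.
move=> c0 fc; apply: le_ereal_inf_tmp => _ [s [s0 Hs] <-].
rewrite lee_fin leNgt; apply/negP => sp.
by have := hausdorff_measure_gt0 c0 s0 (ltW sp) fc; rewrite Hs ltxx.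
Qed.

End HausdorffLowerBound.

(** * Upper bound for the Hausdorff dimension *)

Section HausdorffUpperBound.
Context (R : realType).

Lemma series_harmonic_unbounded (x : R) : exists n, x < series harmonic n.
Proof.
apply: contrapT => /forallNP Hx; apply: (@dvg_harmonic R).
apply: nondecreasing_is_cvgn.
  by apply: nondecreasing_series => n _ _; exact: harmonic_ge0.
by exists x => _ [n _ <-]; rewrite leNgt; apply/negP.
Qed.

Lemma series_harmonic_bracket (x : R) : 0 <= x ->
  exists n, series harmonic n <= x < series harmonic n + n.+1%:R^-1.
Proof.
move=> x0; have [[|n] xn minn] := ex_minnP (series_harmonic_unbounded x).
  by move: xn; rewrite /series /= big_geq// ltNge x0.
exists n; rewrite [_ + _](_ : _ = series harmonic n.+1).
  by rewrite xn andbT leNgt; apply/negP => /minn; rewrite ltnn.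
by rewrite /series /= big_nat_recr.
Qed.

Lemma powR32 (x : R) : 0 <= x -> x `^ (3 / 2) = x * Num.sqrt x.
Proof.
move=> x0; rewrite (_ : 3 / 2 = 1 + 2^-1); last by lra.
by rewrite powRD ?powRr1 ?powR12_sqrt//; apply/implyP => /eqP; lra.
Qed.

(** The summand 1 / (b b b), with b the square root of i + 1, is compared with the
    telescoping difference 2 / a - 2 / b, where a is the square root of i >= 1;
    the term of index 0 accounts for the constant 3. *)
Lemma sum_powR32_le n :
  \sum_(0 <= i < n.+1) (i.+1%:R^-1 : R) `^ (3 / 2) <= 3 - 2 / Num.sqrt n.+1%:R.
Proof.
elim: n => [|n IH].
  by rewrite big_nat1 invr1 powR1 sqrtr1 divr1; lra.
rewrite big_nat_recr//=; apply: le_trans (lerD IH (lexx _)) _.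
rewrite powR32 ?invr_ge0// sqrtrV//.
set a := Num.sqrt n.+1%:R; set b := Num.sqrt n.+2%:R.
have a0 : 0 < a by rewrite sqrtr_gt0.
have b0 : 0 < b by rewrite sqrtr_gt0.
have ab : a <= b by rewrite ler_wsqrtr// ler_nat.
have bE : n.+2%:R = b ^+ 2 by rewrite sqr_sqrtr.
have b2 : b ^+ 2 = a ^+ 2 + 1 by rewrite !sqr_sqrtr// -natr1.
rewrite bE -subr_ge0.
have -> : 3 - 2 / b - (3 - 2 / a + (b ^+ 2)^-1 / b) =
          (2 * b ^+ 2 * (b - a) - a) / (a * b ^+ 3).
  by field; rewrite !gt_eqF.
rewrite divr_ge0 ?mulr_ge0 ?exprn_ge0 ?(ltW a0) ?(ltW b0)//.
have : 1 <= 2 * b * (b - a) by nra.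
nra.
Qed.

Lemma series_powR32_le :
  (\sum_(0 <= i <oo) ((i.+1%:R^-1 : R) `^ (3 / 2))%:E <= 3%:E)%E.
Proof.
apply: lime_le; first by apply: is_cvg_nneseries => i _ _; rewrite lee_fin powR_ge0.
apply: nearW => n; rewrite sumEFin lee_fin.
apply: le_trans (le_trans (sum_powR32_le n) _).
  by rewrite big_nat_recr//= lerDl powR_ge0.
by rewrite lerBlDr lerDl divr_ge0 ?sqrtr_ge0.
Qed.

Context (f : R -> R) (gf : gauge f).
Local Notation M := (metric_space (gauge_distance gf)).

(** Segments of length t / (i + 1), centred on the nonnegative half-line for even i
    and on the nonpositive one for odd i, so that a single sequence runs to
    infinity in both directions. *)
Definition harmonic_piece (t : R) (i : nat) : set R :=
  [set y | `|y - (-1) ^+ odd i * (t / 4) * series harmonic i./2| <= t / (2 * i.+1%:R)].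

(** Divergence of the harmonic series brackets |y| between consecutive centres.
    The step between the centres of index n is t / (4 (n + 1)), which is at most
    the half-length of the pieces 2 n and 2 n + 1 on the two sides. *)
Lemma harmonic_pieces_cover (t : R) : 0 < t ->
  [set: R] `<=` \bigcup_i harmonic_piece t i.
Proof.
move=> t0 y _.
have t4 : 0 < t / 4 by rewrite divr_gt0.
have [n] := @series_harmonic_bracket (`|y| / (t / 4)) (divr_ge0 (normr_ge0 _) (ltW t4)).
rewrite ler_pdivlMr// ltr_pdivrMr// => /andP[lo hi].
have stepE : t / (4 * n.+1%:R) = n.+1%:R^-1 * (t / 4).
  by rewrite invfM mulrA mulrC.
have close : `| `|y| - (t / 4) * series harmonic n | <= t / (4 * n.+1%:R).
  rewrite stepE [t / 4 * _]mulrC ger0_norm ?subr_ge0//.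
  by rewrite lerBlDl -mulrDl ltW.
have wide (b : bool) : t / (4 * n.+1%:R) <= t / (2 * (b + n.*2).+1%:R).
  rewrite ler_pM2l// lef_pV2 ?posrE ?mulr_gt0//.
  rewrite -[4%R]/(2 * 2)%:R natrM -mulrA ler_pM2l// -natrM ler_nat.
  by case: b; rewrite mul2n doubleS ?addSn// ltnW.
exists ((y < 0)%R + n.*2)%N => //; rewrite /harmonic_piece /= half_bit_double.
apply: le_trans (wide _); rewrite oddD odd_double addbF oddb.
apply: le_trans close; case: ltP => y0.
  rewrite (ltr0_norm y0) -[leRHS]normrN expr1.
  by rewrite (_ : y - _ = - (- y - t / 4 * series harmonic n)) ?normrN//; ring.
by rewrite (ger0_norm y0) expr0 mul1r.
Qed.

Local Open Scope ereal_scope.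

(** For the harmonic pieces of parameter t <= 1 the sum of the s-th powers of the
    diameters is at most t^(3/2) times a convergent series, hence at most 3 t. *)
Lemma hausdorff_measure_eq0 (s : R) : (0 < s)%R ->
  (forall t, 0 <= t -> f t `^ s <= t `^ (3 / 2))%R ->
  hausdorff_measure s [set: M] = 0.
Proof.
move=> s0 fs.
have content_ge0 d : 0 <= hausdorff_content s d [set: M].
  apply: le_ereal_inf_tmp => _ [U _ <-].
  by apply: nneseries_ge0 => i _ _; exact: poweR_ge0.
apply/eqP; rewrite eq_le; apply/andP; split; last first.
  apply: le_trans (content_ge0 1%R) _; apply: ereal_sup_ubound.
  by exists 1%R => //=.
apply: ge_ereal_sup => _ [d /= d0 <-].
apply/lee_addgt0Pr => e e0; rewrite add0e.
have [t0 t00 ft0] := gauge_small gf d0.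
pose t := Num.min t0 (Num.min 1 (e / 3))%R.
have tp : (0 < t)%R by rewrite !lt_min t00 ltr01 divr_gt0.
have t1 : (t <= 1)%R by rewrite !ge_min lexx orbT.
have te : (t <= e / 3)%R by rewrite !ge_min lexx !orbT.
have r0 i : (0 <= t / i.+1%:R)%R by rewrite divr_ge0 ?(ltW tp).
have diamU i : diam (harmonic_piece t i : set M) <= (f (t / i.+1%:R))%:E.
  apply: diam_le => // x y; rewrite /harmonic_piece /=.
  rewrite (_ : (t / (2 * i.+1%:R) = t / i.+1%:R / 2)%R); last first.
    by rewrite invfM mulrCA mulrC.
  move: (t / i.+1%:R)%R ((-1) ^+ odd i * _ * _)%R => w z.
  by rewrite !ler_norml => /andP[? ?] /andP[? ?]; apply/andP; split; lra.
apply: (@le_trans _ _ (\sum_(0 <= i <oo) (diam (harmonic_piece t i : set M) `^ s))).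
  apply: ereal_inf_lbound; exists (harmonic_piece t : nat -> set M) => //; split.
    exact: harmonic_pieces_cover.
  move=> i; apply: le_trans (diamU i) _; rewrite lee_fin.
  apply: le_trans (ltW ft0); apply: (gauge_le gf) => //.
  apply: (@le_trans _ _ t); last by rewrite ge_min lexx.
  by rewrite ler_piMr ?(ltW tp)// invf_le1// ler1n.
apply: (@le_trans _ _ (\sum_(0 <= i <oo) (t%:E * ((i.+1%:R^-1 : R) `^ (3 / 2))%:E))).
  apply: lee_nneseries => [i _ _|i _]; first exact: poweR_ge0.
  apply: (@le_trans _ _ ((f (t / i.+1%:R))%:E `^ s)).
    by apply: gt0_ler_poweR (diamU i); rewrite ?(ltW s0)// in_itv /= leey andbT
       ?diam_ge0// lee_fin (gauge_ge0 gf).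
  rewrite poweR_EFin -EFinM lee_fin; apply: le_trans (fs _ (r0 i)) _.
  rewrite powRM ?(ltW tp)// ler_wpM2r ?powR_ge0//.
  by rewrite -[leRHS]powRr1 ?(ltW tp)// ger_powR ?tp//; lra.
rewrite nneseriesZl => [|i _]; last by rewrite lee_fin powR_ge0.
apply: (@le_trans _ _ (t%:E * 3%:E)).
  by rewrite lee_wpmul2l ?series_powR32_le// lee_fin ltW.
by rewrite -EFinM lee_fin; lra.
Qed.

Lemma hausdorff_dim_le (s : R) : (0 < s)%R ->
  (forall t, 0 <= t -> f t `^ s <= t `^ (3 / 2))%R ->
  hausdorff_dim M <= s%:E.
Proof.
move=> s0 fs; apply: ereal_inf_lbound; exists s => //=.
by split => //; exact: hausdorff_measure_eq0.
Qed.

End HausdorffUpperBound.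

(** * Topological dimension *)

(** A dimension below 2 is witnessed by some integer k - 1 < 2, hence k - 1 <= 1. *)
Lemma topological_dim_notin_itv12 (R : realType) (T : topologicalType) (v : \bar R) :
  (1%:E < v)%E -> (v < 2%:E)%E -> topological_dim R T <> v.
Proof.
move=> v1 v2 tv; have := v2; rewrite -tv => /ereal_inf_lt[_ [k Hk <-]].
rewrite lte_fin => k2; have {k2} : (k%:R < 3%:R :> R)%R by lra.
rewrite ltr_nat ltnS => k2.
move: v1; rewrite ltNge => /negP; apply; rewrite -tv.
apply: (@le_trans _ _ (k%:R - 1)%:E); first by apply: ereal_inf_lbound; exists k.
by move: k2; rewrite -(ler_nat R) lee_fin => k2; lra.
Qed.

(** * Lower bound for the Assouad dimension *)

Lemma gt1_powR (R : realType) (x r : R) : 1 < x -> 0 < r -> 1 < x `^ r.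
Proof.
move=> x1 r0; have := @gt0_ltr_powR _ _ r0 1 x.
by rewrite powR1 !nnegrE => -> //; rewrite ltW// (lt_trans _ x1).
Qed.

Section AssouadLowerBound.
Context (R : realType) (f : R -> R) (gf : gauge f).
Local Notation M := (metric_space (gauge_distance gf)).

(** The hypothesis says that f t = t^(1/p) for t >= 1.  The segment [0, D^p] has
    diameter D, and sets of diameter at most 1 have Euclidean width at most 1, so
    covering it takes at least D^p / 2 of them.  Taking eps = 1 / D, an admissible
    exponent b gives D^p <= 2 C D^b for all D > 1, which forces b >= p. *)
Lemma assouad_dim_ge (p : R) : 0 < p ->
  (forall D, 1 <= D -> f (D `^ p) = D) ->
  (p%:E <= assouad_dim M)%E.
Proof.
move=> p0 fp; apply: le_ereal_inf_tmp => _ [b [b0 [C C1 HC]] <-].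
rewrite lee_fin leNgt; apply/negP => bp.
have f_le1 t : 0 <= t -> f t <= 1 -> t <= 1.
  move=> t0; apply: contraTT; rewrite -!ltNge => t1.
  have Dt := @gt1_powR R _ p^-1 t1; rewrite invr_gt0 in Dt.
  have -> : t = (t `^ p^-1) `^ p by rewrite -powRrM mulVf ?powRr1// gt_eqF.
  by rewrite fp ?Dt// ltW// Dt.
(* chosen so that D^(p - b) = 2 C + 1 exceeds 2 C *)
pose D := (2 * C + 1) `^ (p - b)^-1.
have C0 : 0 < C by apply: lt_trans C1.
have D1 : 1 < D by rewrite gt1_powR ?invr_gt0 ?subr_gt0// ltrDr mulr_gt0.
have D0 : 0 < D by apply: lt_trans D1.
have DpE : D `^ p = D `^ b * (2 * C + 1).
  have Dpb : D `^ (p - b) = 2 * C + 1.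
    rewrite /D -powRrM mulVf ?subr_eq0 ?gt_eqF// powRr1// addr_ge0// mulr_ge0//.
    exact: ltW.
  by rewrite -Dpb -powRD ?gt_eqF ?implybT// addrC subrK.
pose A : set M := [set` `[0, D `^ p]].
have diamA : diam A = D%:E.
  apply/eqP; rewrite eq_le; apply/andP; split.
    rewrite -[leRHS](congr1 EFin (fp D (ltW D1))); apply: diam_le; first exact: powR_ge0.
    move=> x y; rewrite /A /= !in_itv /= => /andP[? ?] /andP[? ?].
    by rewrite ler_norml; apply/andP; split; lra.
  have A0 : A 0 by rewrite /A /= in_itv /= lexx powR_ge0.
  have AD : A (D `^ p) by rewrite /A /= in_itv /= lexx powR_ge0.
  apply: le_trans (diam_ge AD A0).
  by rewrite lee_fin gauge_mdistE subr0 ger0_norm ?powR_ge0// fp// ltW.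
have epsD : 0 < D^-1 < 1 by rewrite invr_gt0 D0 invf_lt1.
have [n [U [nC AU Ud]]] := HC D D^-1 D0 epsD A diamA.
(* the finite cover, padded with empty sets of width 0 *)
pose V i : set R := if (i < n)%N then U i else set0.
pose r i : R := (i < n)%:R.
have : ((D `^ p - 0)%:E <= \sum_(0 <= i <oo) (2 * r i)%:E)%E.
  apply: (@itv_cover_le_sum R 0 (D `^ p) V) => [i|i x y|x Ax]; rewrite /r /V.
  - by [].
  - case: ifP => // ni Ux Uy; apply: f_le1 => //.
    have fU : ((f `|x - y|)%:E <= diam (U i))%E by exact: (diam_ge Ux Uy).
    have := le_trans fU (Ud i ni).
    by rewrite mulVf ?gt_eqF// lee_fin.
  - by have [i /= ni Ux] := AU x Ax; exists i => //; rewrite ni.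
rewrite (nneseries_split 0 n) => [|i _]; last by rewrite lee_fin mulr_ge0.
rewrite add0n eseries0 => [|i ni _]; last by rewrite /r ltnNge ni mulr0.
rewrite adde0 sumEFin lee_fin subr0.
rewrite [leRHS](_ : _ = 2 * n%:R); last first.
  rewrite (eq_big_nat _ _ (F2 := fun=> 2)) => [|i /andP[_ ni]].
    by rewrite sumr_const_nat subn0 mulr_natr.
  by rewrite /r ni mulr1.
apply/negP; rewrite -ltNge DpE.
apply: (@le_lt_trans _ _ (2 * (C * D `^ b))).
  rewrite ler_pM2l// (le_trans nC)//.
  by rewrite -(powR_inv1 (ltW D0)) -powRrM mulrNN mul1r.
by have := powR_gt0 b D0; nra.
Qed.

End AssouadLowerBound.

(** * A gauge with different small and large scale exponents *)

Section TwoScaleGauge.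
Context (R : realType).

Definition two_scale_gauge (t : R) : R := Num.min (t `^ (4 / 5)) (t `^ (1 / 4)).

Lemma two_scale_gauge_gauge : gauge two_scale_gauge.
Proof. by apply: gauge_min; apply: gauge_powR; lra. Qed.

Lemma two_scale_gauge_le1 (t : R) : 0 <= t -> two_scale_gauge t <= 1 ->
  t <= two_scale_gauge t `^ (5 / 4).
Proof.
move=> t0; rewrite /two_scale_gauge.
have p45 : (4 / 5 : R) * (5 / 4) = 1 by field.
have [t1|t1] := leP t 1.
  rewrite min_l; first by rewrite -powRrM p45 powRr1.
  move: t0; rewrite [0 <= t]le_eqVlt => /predU1P[<-|t0].
    by rewrite !powR0//; apply/eqP; lra.
  by rewrite ger_powR ?t0//; lra.
by rewrite leNgt lt_min !gt1_powR//; lra.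
Qed.

(** The exponent 15/8 < 2 is chosen so that 4/5 * 15/8 = 3/2 > 1, which makes the
    series of the harmonic cover converge. *)
Lemma two_scale_gauge_powR_le (t : R) : 0 <= t ->
  two_scale_gauge t `^ (15 / 8) <= t `^ (3 / 2).
Proof.
move=> t0; rewrite (_ : 3 / 2 = (4 / 5) * (15 / 8)); last by field.
rewrite [leRHS]powRrM ge0_ler_powR ?nnegrE ?powR_ge0//; last by rewrite ge_min lexx.
exact: (gauge_ge0 two_scale_gauge_gauge).
Qed.

Lemma two_scale_gauge_large (D : R) : 1 <= D -> two_scale_gauge (D `^ 4) = D.
Proof.
move=> D1; rewrite /two_scale_gauge -!powRrM.
rewrite (_ : 4 * (1 / 4) = 1) ?powRr1 ?(le_trans _ D1)//; last by field.
by rewrite min_r// le1r_powR//; lra.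
Qed.

End TwoScaleGauge.

(** * The two distances *)

Lemma hausdorff_dim_slow_gauge (R : realType) :
  hausdorff_dim (metric_space (gauge_distance (slow_gauge_gauge R))) = +oo%E.
Proof.
apply/eqyP => A A0; pose n := Num.truncn A.
apply: (@le_trans _ _ (n.+1%:R)%:E); first by rewrite lee_fin ltW// truncnS_gt.
have n0 : 0 < n.+1%:R :> R by [].
apply: (@hausdorff_dim_ge _ _ _ _ (n.+1%:R `^ n.+1%:R)) => [|t t0 _].
  exact: powR_gt0.
apply: (@le_trans _ _ (n.+1%:R `^ n.+1%:R * root_family t n `^ n.+1%:R)).
  rewrite -powRM ?(ltW n0) ?divr_ge0 ?powR_ge0//.
  by rewrite /root_family mulrC divfK ?gt_eqF// -powRrM mulVf ?gt_eqF// powRr1.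
rewrite ler_wpM2l ?powR_ge0// ge0_ler_powR ?nnegrE ?slow_gauge_ge//.
- by rewrite divr_ge0 ?powR_ge0.
- exact: (gauge_ge0 (slow_gauge_gauge R)).
Qed.

Theorem theorem1p12 (R : realType) :
  exists d1 d2 : distance R,
    [/\ translation_invariant d1, proper_space (metric_space d1)
      & induces_standard_topology d1] /\
    [/\ translation_invariant d2, proper_space (metric_space d2)
      & induces_standard_topology d2] /\
    hausdorff_dim (metric_space d1) = +oo%E /\
    topological_dim R (metric_space d2) <> hausdorff_dim (metric_space d2) /\
    hausdorff_dim (metric_space d2) <> assouad_dim (metric_space d2).
Proof.
have g2 := two_scale_gauge_gauge R.
exists (gauge_distance (slow_gauge_gauge R)), (gauge_distance g2).
have admissible f (gf : gauge f) :
    [/\ translation_invariant (gauge_distance gf),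
        proper_space (metric_space (gauge_distance gf))
      & induces_standard_topology (gauge_distance gf)].
  split; [exact: gauge_distance_translation_invariant
         |exact: gauge_distance_proper|exact: gauge_distance_standard].
have dimH_ge : ((5 / 4)%:E <= hausdorff_dim (metric_space (gauge_distance g2)))%E.
  apply: (@hausdorff_dim_ge R _ g2 _ 1) => // t t0 ft1; rewrite mul1r.
  exact: two_scale_gauge_le1.
have dimH_le : (hausdorff_dim (metric_space (gauge_distance g2)) <= (15 / 8)%:E)%E.
  by apply: hausdorff_dim_le; [lra|exact: two_scale_gauge_powR_le].
have dimA_ge : (4%:E <= assouad_dim (metric_space (gauge_distance g2)))%E.
  by apply: assouad_dim_ge; [lra|exact: two_scale_gauge_large].
split; first exact: admissible.
split; first exact: admissible.
split; first exact: hausdorff_dim_slow_gauge.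
split.
  apply: topological_dim_notin_itv12.
    by apply: lt_le_trans dimH_ge; rewrite lte_fin; lra.
  by apply: le_lt_trans dimH_le _; rewrite lte_fin; lra.
move=> dimHA; move: dimA_ge; rewrite -dimHA => /le_trans/(_ dimH_le).
by rewrite lee_fin; lra.
Qed.
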